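(* Let $k$ and $n$ be integers larger than $1$ and consider a $\sigma_n$-$k$-partition with defining sequence $a_1,\dots,a_{\lfloor n/2\rfloor}$. There exists a standard orientation for this $\sigma_n$-$k$-partition if and only if $n$ is divisible by $2k$ and the defining sequence $a_1a_2\dots a_{n/2}$ satisfies that for every $1\le j\le n/2-1$ either $a_{j+1}=a_j$ or $a_{j+1}\equiv a_j+1\pmod k$. If a standard orientation exists, then it is unique up to shifts of $\sigma_n^k$ (that is, any two standard orientations of the partition are carried to each other by a power of $\sigma_n^k$), and the corresponding bitonic ordering of the vertices satisfies that the first and last elements in the ordering (the unique local minimum and the unique local maximum) differ by $n/2$ (modulo $n$).
   Context: $K_n$ is the complete graph on the vertex set $[n]=\{0,1,\dots,n-1\}$; vertices are considered as residue classes modulo $n$, and $\sigma_n$ is the cyclic permutation of $[n]$ with $\sigma_n(i)=i+1$ (mod $n$), acting also on edges, graphs and digraphs. A $\sigma_n$-$k$-partition is a partition of the edge set of $K_n$ into subgraphs $F_0,\dots,F_{k-1}$ with $\sigma_n(F_d)=F_{d+1}$ for $0\le d<k-1$. (This forces $k\mid n$, and $2k\mid n$ if $k$ is even; also $\sigma_n(F_{k-1})=F_0$.) The label of an edge $e\in F_d$ is $\ell(e)=d$. The defining sequence of the partition is $a_1,\dots,a_{\lfloor n/2\rfloor}$ with $a_i=\ell(\{0,i\})\in\{0,\dots,k-1\}$. A transitive orientation $T$ of $K_n$ (i.e. a transitive tournament on $[n]$) is a transitive $\sigma_n$-orientation of the $\sigma_n$-$k$-partition if $\sigma_n(\vec F_d)=\vec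 F_{d+1}$ for $0\le d<k-1$, where $\vec F_d$ is the orientation of $F_d$ obtained as a subgraph of $T$. An orientation is consistent with an ordering $\tau(1),\dots,\tau(n)$ of $[n]$ if every edge points towards its endpoint that comes later in the ordering; a transitive orientation and the ordering it is consistent with mutually determine each other. A vertex $j$ is a local minimum of $\tau$ if $j$ precedes both $j-1$ and $j+1$ (mod $n$) in $\tau$, and a local maximum if it is preceded by both $j-1$ and $j+1$ (mod $n$). The ordering $\tau$ is bitonic if it has a unique local minimum and a unique local maximum. A standard orientation of a $\sigma_n$-$k$-partition is a transitive $\sigma_n$-orientation of it that is consistent with a bitonic ordering of the vertices. *)

(* Defs.v *)
From mathcomp Require Import all_boot all_fingroup.

Set Implicit Arguments.
Unset Strict Implicit.
Unset Printing Implicit Defensive.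

(* Vertices are 'I_n, edges are two-element sets of vertices, and digraphs are
   sets of arcs (u, v), directed from u to v. *)

Definition sigma (n : nat) : {perm 'I_n} := perm (@ordS_inj n).

Definition complete_graph (n : nat) : {set {set 'I_n}} :=
  [set e : {set 'I_n} | #|e| == 2].

Definition act_graph (n : nat) (s : {perm 'I_n}) (G : {set {set 'I_n}}) :
    {set {set 'I_n}} :=
  [set s @: (e : {set 'I_n}) | e in G].

Definition act_digraph (n : nat) (s : {perm 'I_n}) (D : {set 'I_n * 'I_n}) :
    {set 'I_n * 'I_n} :=
  [set (s a.1, s a.2) | a in D].

Definition sigma_partition (n k : nat) (F : 'I_k -> {set {set 'I_n}}) : Prop :=
  [/\ injective F,
      partition [set F d | d in 'I_k] (complete_graph n) &
      forall d d' : 'I_k, d' = d.+1 :> nat -> act_graph (sigma n) (F d) = F d'].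

(* The default value 0 is never used on edges of K_n when F is a partition. *)
Definition label (n k : nat) (F : 'I_k -> {set {set 'I_n}}) (e : {set 'I_n}) :
    nat :=
  if [pick d | e \in F d] is Some d then nat_of_ord d else 0.

(* The set below is the edge {0, i} when 0 < i < n; writing it this way avoids
   having to exhibit 0 and i as elements of 'I_n. *)
Definition defining_seq (n k : nat) (F : 'I_k -> {set {set 'I_n}}) (i : nat) :
    nat :=
  label F [set u : 'I_n | (u == 0 :> nat) || (u == i :> nat)].

Definition has_arc (n : nat) (T : {set 'I_n * 'I_n}) : rel 'I_n :=
  [rel u v | (u, v) \in T].

Definition transitive_orientation (n : nat) (T : {set 'I_n * 'I_n}) : Prop :=
  [/\ irreflexive (has_arc T),
      forall u v : 'I_n, u != v -> has_arc T u v (+) has_arc T v u &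
      transitive (has_arc T)].

Definition oriented_subgraph (n : nat) (T : {set 'I_n * 'I_n})
    (G : {set {set 'I_n}}) : {set 'I_n * 'I_n} :=
  [set a in T | [set a.1; a.2] \in G].

Definition transitive_sigma_orientation (n k : nat)
    (F : 'I_k -> {set {set 'I_n}}) (T : {set 'I_n * 'I_n}) : Prop :=
  transitive_orientation T /\
  forall d d' : 'I_k, d' = d.+1 :> nat ->
    act_digraph (sigma n) (oriented_subgraph T (F d))
    = oriented_subgraph T (F d').

(* An ordering of the vertices is a permutation tau sending each position
   (counted from 0) to the vertex placed there. *)
Definition position (n : nat) (tau : {perm 'I_n}) (u : 'I_n) : nat :=
  (tau^-1)%g u.

Definition precedes (n : nat) (tau : {perm 'I_n}) (u v : 'I_n) : bool :=
  position tau u < position tau v.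

Definition consistent (n : nat) (T : {set 'I_n * 'I_n}) (tau : {perm 'I_n}) :
    Prop :=
  forall u v : 'I_n, has_arc T u v -> precedes tau u v.

Definition local_min (n : nat) (tau : {perm 'I_n}) (j : 'I_n) : bool :=
  precedes tau j (ord_pred j) && precedes tau j (ordS j).

Definition local_max (n : nat) (tau : {perm 'I_n}) (j : 'I_n) : bool :=
  precedes tau (ord_pred j) j && precedes tau (ordS j) j.

Definition bitonic (n : nat) (tau : {perm 'I_n}) : Prop :=
  (exists! j, local_min tau j) /\ (exists! j, local_max tau j).

Definition standard_orientation (n k : nat) (F : 'I_k -> {set {set 'I_n}})
    (T : {set 'I_n * 'I_n}) : Prop :=
  transitive_sigma_orientation F T /\
  exists tau : {perm 'I_n}, consistent T tau /\ bitonic tau.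

(* Main.v *)
Require Import Defs.
From mathcomp Require Import all_boot all_fingroup zify.

Set Implicit Arguments.
Unset Strict Implicit.
Unset Printing Implicit Defensive.

(** Write P(x) for the position of the vertex x modulo n in an ordering, and
    a_d for the label of {0, d}, so that {x, x + d} has label a_d + x modulo k.

    The ordering is bitonic exactly when, for 0 < d < n, the d first vertices
    form a cyclic arc {l_d, ..., l_d + d - 1}.  Such an ordering is grown from
    its first vertex by adding, at each step, the vertex just before or just
    after the current arc: l_{d+1} = l_d - delta_d with delta_d in {0, 1}.  It
    is thus the [spiral] determined by its first vertex and by delta
    ([spiral_of_unimodal], [arc_rank]).

    Follow the edges {x, x + d} as x runs around the cycle.  The edge points
    from x + d to x when x = l_d - 1 and from x to x + d when x = l_d, and this
    is the only place where it changes in this sense ([orientation_flip]); the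
    opposite change is the same one for n - d.  Invariance under the rotation
    forbids a change except when the label passes from k - 1 to 0.  So a spiral
    gives a transitive sigma-orientation if and only if a_d + l_d = 0 modulo k
    for 0 < d < n ([compatible_label_spiral], [label_spiral_compatible]), which
    says that l_1 = - a_1 and a_{d+1} = a_d + delta_d modulo k.

    This yields the condition on the defining sequence, and uniqueness: delta
    is determined by a because k > 1, and the first vertex is determined
    modulo k.  Finally, the two descriptions {0, n - d} and {0, d} of an edge
    up to rotation give a_{n-d} + d = a_d modulo k, hence
    delta_{n-1-d} = 1 - delta_d ([label_steps_rev]).  So delta takes the value
    1 exactly (n - 2)/2 times on {1, ..., n - 2}: n is even, the last vertex is
    opposite to the first, and a_{n/2} + n/2 = a_{n/2} shows that k divides
    n/2.  The same symmetry extends the condition on a from the first half of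
    the indices to all of them ([label_steps_extend]), which gives
    existence. *)

(** * Congruences *)

Lemma modn_offset n b x : 0 < n -> exists2 s, s < n & x = b + s %[mod n].
Proof.
move=> n_gt0; exists ((x + (n - b %% n)) %% n); first exact: ltn_pmod.
rewrite modnDmr -modnDml -[LHS](modnDr x).
by congr (_ %% _); have := ltn_pmod b n_gt0; lia.
Qed.

Lemma modn_succ_neq n x : 1 < n -> x.+1 = x %[mod n] -> False.
Proof.
by move=> n_gt1 /eqP; rewrite -addn1 -[in X in _ == X](addn0 x) eqn_modDl
  !modn_small ?(ltnW n_gt1).
Qed.

Lemma modn_bool_inj k x (b b' : bool) :
  1 < k -> x + b = x + b' %[mod k] -> b = b'.
Proof.
move=> k_gt1 /eqP; rewrite eqn_modDl !modn_small; first by case: b; case: b'.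
  by case: b'; lia.
by case: b; lia.
Qed.

Lemma modn_addKl n p x y : p + x = p + y %[mod n] -> x = y %[mod n].
Proof. by move/eqP; rewrite eqn_modDl => /eqP. Qed.

Lemma dvdn_mod_eq k n x y : k %| n -> x = y %[mod n] -> (k %| x) = (k %| y).
Proof.
by move=> kn xy; rewrite /dvdn -(modn_dvdm x kn) xy (modn_dvdm y kn).
Qed.

(** * Cyclic rankings and spirals *)

(** A ranking of the vertices of the cycle, with vertices given by arbitrary
    natural numbers read modulo n. *)
Definition cyclic_ranking (n : nat) (P : nat -> nat) : Prop :=
  (forall x, P x < n) /\ (forall x y, P x = P y <-> x = y %[mod n]).

(** The booleans delta prescribe how an arc of the cycle grows: the step from
    d to d + 1 vertices adds the vertex before the arc when [delta d] holds,
    and the vertex after it otherwise.  [left_steps delta d] is the number of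
    steps of the first kind among the d first ones. *)
Definition left_steps (delta : nat -> bool) (d : nat) : nat :=
  \sum_(0 <= i < d) delta i.

(** First vertex of the arc of d vertices grown from c; n is added so that the
    subtraction does not truncate for d <= n. *)
Definition arc_start (n c : nat) (delta : nat -> bool) (d : nat) : nat :=
  c + (n - left_steps delta d).

(** The vertex added in the step from d to d + 1 vertices: the first or the last
    vertex of the larger arc. *)
Definition spiral (n c : nat) (delta : nat -> bool) (d : nat) : nat :=
  arc_start n c delta d.+1 + (if delta d then 0 else d).

Lemma left_steps0 delta : left_steps delta 0 = 0.
Proof. by rewrite /left_steps big_geq. Qed.

Lemma left_stepsS delta d :
  left_steps delta d.+1 = left_steps delta d + delta d.
Proof. by rewrite /left_steps big_nat_recr. Qed.

Lemma left_steps_le delta d : left_steps delta d <= d.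
Proof. by elim: d => [|d IHd]; rewrite ?left_steps0 // left_stepsS; lia. Qed.

Lemma arc_startS n c delta d :
  d < n -> arc_start n c delta d = arc_start n c delta d.+1 + delta d.
Proof.
rewrite /arc_start left_stepsS => d_lt_n.
by have := left_steps_le delta d; case: (delta d); lia.
Qed.

Section Spiral.

Variables (n c : nat) (delta : nat -> bool) (P : nat -> nat).
Hypothesis rankP : cyclic_ranking n P.

Local Notation l := (arc_start n c delta).
Local Notation w := (spiral n c delta).

Let rank_lt x : P x < n. Proof. by case: rankP. Qed.
Let rank_eq x y : P x = P y <-> x = y %[mod n]. Proof. by case: rankP. Qed.
Let rank_mod x y : x = y %[mod n] -> P x = P y.
Proof. by move/rank_eq. Qed.

(** The d vertices of smallest rank form an arc, as soon as they are the d first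
    vertices of a spiral. *)
Lemma arc_rank d s :
  (forall e, e < d -> P (w e) = e) -> d <= n -> s < n ->
  (P (l d + s) < d) = (s < d).
Proof.
elim: d s => [//|d IHd] s Pw d_lt_n s_lt_n.
have {}IHd t : t < n -> (P (l d + t) < d) = (t < d).
  by apply: IHd => [e e_lt_d|]; [apply: Pw|]; lia.
have rankS x : (P x < d.+1) = (P x < d) || (P x == d) by lia.
have Pwd := Pw d (ltnSn d).
have Pd x : (P x == d) = (x == w d %[mod n]).
  by rewrite -{1}Pwd; apply/eqP/eqP => /rank_eq.
rewrite rankS Pd /spiral; have := arc_startS c delta d_lt_n.
case: (delta d) => lS; rewrite eqn_modDl !modn_small //; try lia.
  case: s s_lt_n => [|s] s_lt_n /=; first by rewrite orbT.
  rewrite orbF (_ : l d.+1 + s.+1 = l d + s) ?IHd; lia.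
rewrite (_ : l d.+1 + s = l d + s) ?IHd; lia.
Qed.

Section Boundary.

Variable t : nat.
Hypothesis n_gt1 : 1 < n.
Hypotheses (Pw : forall e, e < t -> P (w e) = e) (t_le_n : t <= n).

(** The start of an arc is its only point of entry, and the vertex after the arc
    its only point of exit. *)
Lemma arc_entry x : t <= P x -> P x.+1 < t -> x.+1 = l t %[mod n].
Proof.
have [s s_lt_n xE] := modn_offset (l t) x (ltnW n_gt1).
have xSE : x.+1 = l t + s.+1 %[mod n].
  by rewrite addnS -addn1 -modnDml xE modnDml addn1.
rewrite (rank_mod xE) (rank_mod xSE) leqNgt arc_rank // => ts.
have [sS_lt_n|] := ltnP s.+1 n; first by rewrite arc_rank //; lia.
by move=> n_le_sS _; rewrite xSE (_ : s.+1 = n) ?modnDr //; lia.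
Qed.

Lemma arc_exit x : P x < t -> t <= P x.+1 -> x.+1 = l t + t %[mod n].
Proof.
have [s s_lt_n xE] := modn_offset (l t) x (ltnW n_gt1).
have xSE : x.+1 = l t + s.+1 %[mod n].
  by rewrite addnS -addn1 -modnDml xE modnDml addn1.
rewrite (rank_mod xE) (rank_mod xSE) arc_rank // [t <= _]leqNgt => ts.
have [sS_lt_n|] := ltnP s.+1 n.
  by rewrite arc_rank // xSE => tsS; rewrite (_ : s.+1 = t) //; lia.
move=> n_le_sS; rewrite (_ : s.+1 = n); last by lia.
by rewrite (rank_mod (modnDr _ _)) -[l t]addn0 arc_rank //; lia.
Qed.

End Boundary.

End Spiral.

(** A ranking with a unique local minimum is a spiral: a vertex of rank d > 0
    that touches no vertex of smaller rank would be another local minimum.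
    Here r is a right inverse of the ranking. *)
Lemma spiral_of_unimodal n P r :
  1 < n -> cyclic_ranking n P -> (forall d, d < n -> P (r d) = d) ->
  (forall x, P x.+1 < P x -> P x.+1 < P x.+2 -> P x.+1 = 0) ->
  exists delta, delta 0 = false /\
    forall d, d < n -> P (spiral n (r 0) delta d) = d.
Proof.
move=> n_gt1 rankP Pr min0.
have rank_eq x y : P x = P y <-> x = y %[mod n] by case: rankP.
(* The vertex of rank d lies before the arc when its successor is in it; this
   also holds when d = n - 1, where the vertex lies on both sides. *)
pose delta d := P (r d).+1 < d.
exists delta; split=> //.
elim/ltn_ind=> d IHd d_lt_n.
rewrite -[RHS]Pr //; apply/rank_eq.
have [->|d_gt0] := posnP d.
  rewrite /spiral /arc_start left_stepsS left_steps0 /delta ltn0 /=.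
  by rewrite subn0 addn0 modnDr.
have Pw e : e < d -> P (spiral n (r 0) delta e) = e.
  by move=> e_lt_d; apply: IHd => //; lia.
have lS := arc_startS (r 0) delta d_lt_n.
(* x is the predecessor of the vertex of rank d. *)
pose x := r d + n.-1.
have xS : x.+1 = r d %[mod n] by rewrite -addnS prednK ?modnDr //; lia.
have xSS : x.+2 = (r d).+1 %[mod n] by rewrite -addn1 -modnDml xS modnDml addn1.
have PxS : P x.+1 = d by rewrite (proj2 (rank_eq _ _) xS) Pr.
have PxSS := proj2 (rank_eq _ _) xSS.
rewrite /spiral -xS; move: lS; case: ifP => [Pnext|/negbT Pnext].
  move=> lS; apply: (@modn_addKl n 1); rewrite addn0 !add1n.
  have := arc_entry rankP n_gt1 Pw (ltnW d_lt_n) (x := x.+1).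
  by rewrite PxS PxSS lS addn1 => ->.
rewrite addn0 => <-.
rewrite (arc_exit rankP n_gt1 Pw (ltnW d_lt_n) (x := x)) ?PxS //.
rewrite ltnNge; apply/negP => Px.
have := min0 x; rewrite PxS PxSS.
have Pnext_neq : P (r d).+1 <> d.
  by rewrite -{2}[d]Pr // => /rank_eq /modn_succ_neq; apply.
have Px_neq : P x <> d.
  by rewrite -[in RHS]PxS => /esym /rank_eq /modn_succ_neq; apply.
have x_gt : d < P x by lia.
have r_gt : d < P (r d).+1 by move: Pnext; rewrite /delta; lia.
by move=> /(_ x_gt r_gt); lia.
Qed.


Lemma spiral_local_min n c delta P x :
  1 < n -> cyclic_ranking n P ->
  (forall d, d < n -> P (spiral n c delta d) = d) ->
  P x.+1 < P x -> P x.+1 < P x.+2 -> P x.+1 = 0.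
Proof.
move=> n_gt1 rankP Pw lt_prev lt_next.
have rank_lt y : P y < n by case: rankP.
(* The arc {P < t} is entered at x + 1 and left just after it. *)
pose t := (P x.+1).+1.
have t_le_n : t <= n by rewrite /t.
have Pwt e : e < t -> P (spiral n c delta e) = e.
  by move=> e_lt_t; apply: Pw; lia.
have entry := arc_entry rankP n_gt1 Pwt t_le_n (x := x).
have exit := arc_exit rankP n_gt1 Pwt t_le_n (x := x.+1).
have : x.+1 + t = x.+1 + 1 %[mod n].
  by rewrite -modnDml entry ?modnDml -?exit ?addn1 // /t; lia.
have := rank_lt x.+2.
by move=> ? /modn_addKl; rewrite !modn_small // /t; lia.
Qed.

Lemma spiral_local_max n c delta P x :
  1 < n -> cyclic_ranking n P ->
  (forall d, d < n -> P (spiral n c delta d) = d) ->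
  P x < P x.+1 -> P x.+2 < P x.+1 -> P x.+1 = n.-1.
Proof.
move=> n_gt1 rankP Pw gt_prev gt_next.
have rank_lt y : P y < n by case: rankP.
(* The arc {P < t} is left at x + 1 and entered just after it. *)
pose t := P x.+1.
have t_lt_n : t < n by rewrite /t.
have Pwt e : e < t -> P (spiral n c delta e) = e.
  by move=> e_lt_t; apply: Pw; lia.
have entry := arc_entry rankP n_gt1 Pwt (ltnW t_lt_n) (x := x.+1).
have exit := arc_exit rankP n_gt1 Pwt (ltnW t_lt_n) (x := x).
have : x.+1 + n = x.+1 + t.+1 %[mod n].
  by rewrite addnS -addSn -[RHS]modnDml entry // modnDml modnDr -exit.
move/modn_addKl; rewrite modnn -/t; have [tS_lt_n|] := ltnP t.+1 n.
  by rewrite modn_small.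
by lia.
Qed.

(** Along a spiral, the edge {y, y + d} starts to point from y to y + d only
    when y is the start of the arc of d vertices. *)
Lemma orientation_flip n c delta P d x :
  1 < n -> cyclic_ranking n P ->
  (forall e, e < n -> P (spiral n c delta e) = e) -> 0 < d < n ->
  P (x + d) < P x -> P x.+1 < P (x.+1 + d) ->
  x.+1 = arc_start n c delta d %[mod n].
Proof.
move=> n_gt1 rankP Pw /andP[d_gt0 d_lt_n]; rewrite addSn => down up.
have rank_lt y : P y < n by case: rankP.
have rank_eq y z : P y = P z <-> y = z %[mod n] by case: rankP.
have Pwt t e : t <= n -> e < t -> P (spiral n c delta e) = e.
  by move=> t_le_n e_lt_t; apply: Pw; lia.
have entry t y t_le_n :=
  arc_entry rankP n_gt1 (Pwt t ^~ t_le_n) t_le_n (x := y).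
have exit t y t_le_n :=
  arc_exit rankP n_gt1 (Pwt t ^~ t_le_n) t_le_n (x := y).
have d_mod : (x + d).+1 = x.+1 %[mod n] -> False.
  rewrite -addSn -[in X in _ = X](addn0 x.+1) => /modn_addKl.
  by rewrite !modn_small ?(ltnW n_gt1) //; lia.
have succ_neq y : P y <> P y.+1 by move/esym/rank_eq/modn_succ_neq; apply.
have neq1 := succ_neq x; have neq2 := succ_neq (x + d).
(* If P x < P (x + 1), then the arc of vertices of rank at most P x would be
   left both after x and after x + d. *)
have [lt1|ge1] := ltnP (P x) (P x.+1).
  pose t := (P x).+1; have t_le_n : t <= n by apply: rank_lt.
  by case: d_mod; rewrite (exit t) 1?(exit t x) // /t; lia.
(* If P (x + d + 1) < P (x + d), then the arc of vertices of rank at most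
   P (x + d + 1) would be entered both at x + 1 and at x + d + 1. *)
have [lt2|ge2] := ltnP (P (x + d).+1) (P (x + d)).
  pose t := (P (x + d).+1).+1; have t_le_n : t <= n by apply: rank_lt.
  by case: d_mod; rewrite (entry t) 1?(entry t x) // /t; lia.
(* Otherwise one arc is entered at x + 1 and left at x + d + 1, so it has d
   vertices. *)
pose t := minn (P x) (P (x + d).+1).
have t_lt_n : t < n by have := rank_lt x; rewrite /t; lia.
have entry_x : x.+1 = arc_start n c delta t %[mod n].
  by apply: entry; rewrite /t; lia.
have exit_xd : (x + d).+1 = arc_start n c delta t + t %[mod n].
  by apply: exit; rewrite /t; lia.
have /modn_addKl : x.+1 + d = x.+1 + t %[mod n].
  by rewrite addSn exit_xd -[RHS]modnDml entry_x modnDml.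
by rewrite (modn_small d_lt_n) (modn_small t_lt_n) => ->.
Qed.

(** * Orientations compatible with the rotation *)

(** The properties of the labels a_d of the edges {0, d}, for 0 < d < n, in a
    cyclic partition: {0, n - d} is sent to {d, 0} by d rotations. *)
Definition label_sequence (n k : nat) (a : nat -> nat) : Prop :=
  (forall d, 0 < d < n -> a d < k) /\
  (forall d, 0 < d < n -> a (n - d) + d = a d %[mod k]).

(** The orientation of {x, x + d} agrees with that of {x + 1, x + d + 1}, except
    possibly when the label of the latter, a_d + x + 1 modulo k, is 0. *)
Definition rotation_compatible (n k : nat) (a P : nat -> nat) : Prop :=
  forall x d, 0 < d < n -> ~~ (k %| a d + x.+1) ->
    (P x < P (x + d)) = (P x.+1 < P (x.+1 + d)).

(** The edge {l_d, l_d + d} has label 0, where l_d is the start of the arc of d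
    vertices. *)
Definition label_spiral (n k c : nat) (a : nat -> nat) (delta : nat -> bool) :
    Prop :=
  forall d, 0 < d < n -> k %| a d + arc_start n c delta d.

Lemma compatible_label_spiral n k c a delta P :
  1 < n -> cyclic_ranking n P ->
  (forall d, d < n -> P (spiral n c delta d) = d) ->
  rotation_compatible n k a P -> label_spiral n k c a delta.
Proof.
move=> n_gt1 rankP Pw compP d /andP[d_gt0 d_lt_n].
have rank_mod x y : x = y %[mod n] -> P x = P y by case: rankP => _ ->.
have Pwd e : e < d -> P (spiral n c delta e) = e.
  by move=> e_lt_d; apply: Pw; lia.
have arc := arc_rank rankP Pwd (ltnW d_lt_n).
set l := arc_start n c delta d in arc *.
have l_gt0 : 0 < l.
  by have := left_steps_le delta d; rewrite /l /arc_start; lia.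
have := arc 0 (ltnW n_gt1); have := arc d.-1; have := arc d d_lt_n.
have := arc n.-1; have -> : P (l + n.-1) = P l.-1.
  by apply: rank_mod; rewrite -[RHS]modnDr; congr (_ %% _); lia.
rewrite addn0 => out_pred out_d in_pred in_l.
have := compP l.-1 d; rewrite prednK // d_gt0 d_lt_n => /(_ isT) comp.
have predE : l.-1 + d = l + d.-1 by lia.
apply: contraT => /comp; rewrite predE.
by lia.
Qed.

Lemma label_spiral_compatible n k c a delta P :
  1 < n -> label_sequence n k a -> cyclic_ranking n P ->
  (forall d, d < n -> P (spiral n c delta d) = d) ->
  k %| n -> label_spiral n k c a delta -> rotation_compatible n k a P.
Proof.
move=> n_gt1 lab_a rankP Pw kn lab_l.
have rank_eq y z : P y = P z <-> y = z %[mod n] by case: rankP.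
have flip d x : 0 < d < n -> P (x + d) < P x -> P x.+1 < P (x.+1 + d) ->
    k %| a d + x.+1.
  move=> d_n down up.
  have xE := orientation_flip n_gt1 rankP Pw d_n down up.
  rewrite (@dvdn_mod_eq k n _ (a d + arc_start n c delta d)) ?lab_l //.
  by rewrite -modnDmr xE modnDmr.
have neq d x : 0 < d < n -> P x <> P (x + d).
  move=> d_n; rewrite -[in P x](addn0 x) => /rank_eq/modn_addKl.
  by rewrite !modn_small; lia.
move=> x d d_n; apply: contraNeq => P_neq.
have := neq d x d_n; have := neq d x.+1 d_n => neq1 neq2.
have [down|up] := ltnP (P (x + d)) (P x); first by apply: flip => //; lia.
have nd_n : 0 < n - d < n by lia.
have back y : P (y + d + (n - d)) = P y.
  by apply/rank_eq; rewrite -addnA subnKC ?modnDr //; lia.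
(* The edge stops pointing from x to x + d: written as
   {x + d, x + d + (n - d)}, it starts to point from its first to its second
   end. *)
have := flip (n - d) (x + d) nd_n; rewrite -addSn !back.
move=> /(_ ltac:(lia) ltac:(lia)).
case: lab_a => _ /(_ d d_n) sym_d.
rewrite (_ : a (n - d) + _ = a (n - d) + d + x.+1); last by lia.
by rewrite /dvdn -modnDml sym_d modnDml.
Qed.

Lemma label_spiral_step n k c a delta d :
  label_spiral n k c a delta -> 0 < d < n.-1 ->
  a d.+1 = a d + delta d %[mod k].
Proof.
move=> lab_l d_n.
have [d_lt_n dS_lt_n] : 0 < d < n /\ 0 < d.+1 < n by lia.
have := lab_l _ d_lt_n; have := lab_l _ dS_lt_n.
rewrite (@arc_startS n c delta d); last by lia.
set l := arc_start _ _ _ _; rewrite (addnC l) addnA /dvdn => /eqP l1 /eqP l2.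
by apply/eqP; rewrite -(eqn_modDr l) l1 l2.
Qed.

(** The symmetry a_{n-d} + d = a_d on the increments of a. *)
Lemma label_steps_rev n k a (delta : nat -> bool) d :
  1 < k -> label_sequence n k a ->
  (forall e, 0 < e < n.-1 -> a e.+1 = a e + delta e %[mod k]) ->
  0 < d < n.-1 -> delta (n.-1 - d) = ~~ delta d.
Proof.
move=> k_gt1 [_ sym] step d_n.
pose e := n.-1 - d; have e_n : 0 < e < n.-1 by rewrite /e; lia.
have ndE : n - d = e.+1 by rewrite /e; lia.
have sym_d : a e.+1 + d = a d %[mod k] by rewrite -ndE; apply: sym; lia.
have sym_dS : a e + d.+1 = a d.+1 %[mod k].
  by rewrite (_ : e = n - d.+1); [apply: sym | rewrite /e]; lia.
have : a d + delta d + delta e = a d + 1 %[mod k].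
  rewrite -modnDml -step // -sym_dS modnDml -[RHS]modnDml -sym_d modnDml.
  rewrite (_ : a e + d.+1 + delta e = a e + delta e + d.+1); last by lia.
  by rewrite -modnDml -step // modnDml addnS addn1.
rewrite -/e; case: (delta d) => /= E.
  by apply: (modn_bool_inj (x := a d + 1) k_gt1); rewrite addn0.
by apply: (modn_bool_inj (x := a d) k_gt1); rewrite addn0 in E.
Qed.

(** Pairing d with n - 1 - d, half of the indices 1, ..., n - 2 are left steps.
    In particular n is even. *)
Lemma left_steps_half n k a (delta : nat -> bool) :
  1 < n -> 1 < k -> label_sequence n k a -> delta 0 = false ->
  (forall e, 0 < e < n.-1 -> a e.+1 = a e + delta e %[mod k]) ->
  (left_steps delta n.-1).*2.+2 = n.
Proof.
move=> n_gt1 k_gt1 lab_a delta0 step.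
have tailE : left_steps delta n.-1 = \sum_(1 <= i < n.-1) delta i.
  by rewrite /left_steps big_ltn ?delta0 //; lia.
suff : left_steps delta n.-1 + left_steps delta n.-1 = n.-2 by lia.
rewrite {1}tailE big_nat_rev tailE -big_split /=.
rewrite (eq_big_nat _ _ (F2 := fun=> 1)) => [|i i_n].
  by rewrite sum_nat_const_nat muln1; lia.
rewrite (_ : 1 + n.-1 - i.+1 = n.-1 - i); last by lia.
by rewrite (label_steps_rev k_gt1 lab_a step) //; case: (delta i).
Qed.

Lemma label_spiral_of_steps n k c a delta :
  k %| n -> delta 0 = false -> k %| a 1 + c ->
  (forall e, 0 < e < n.-1 -> a e.+1 = a e + delta e %[mod k]) ->
  label_spiral n k c a delta.
Proof.
move=> kn delta0 kac step; elim=> [//|d IHd] d_n.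
have lS := arc_startS c delta (ltnW (proj2 (andP d_n))).
have [d_eq0|d_gt0] := posnP d.
  move: lS; rewrite d_eq0 delta0 addn0 => <-.
  by rewrite /arc_start left_steps0 subn0 addnA dvdn_addl.
move: IHd; rewrite lS (addnC _ (nat_of_bool _)) addnA /dvdn => /(_ ltac:(lia)).
by rewrite -modnDml -step ?modnDml //; lia.
Qed.

(** The same symmetry carries the condition on the increments of a from the
    first half of the indices to the second one. *)
Lemma label_steps_extend n k a :
  label_sequence n k a -> 2 %| n ->
  (forall j, 0 < j <= n %/ 2 - 1 ->
    a j.+1 = a j \/ a j.+1 = a j + 1 %[mod k]) ->
  forall e, 0 < e < n.-1 -> a e.+1 = a e \/ a e.+1 = a e + 1 %[mod k].
Proof.
move=> [a_lt sym] n_even step e e_n.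
have [a_e a_eS] : a e < k /\ a e.+1 < k by split; apply: a_lt; lia.
have [e_le|e_gt] := leqP e (n %/ 2 - 1); first by apply: step; lia.
pose j := n.-1 - e; have j_n : 0 < j <= n %/ 2 - 1 by rewrite /j; lia.
have sym_j : a e.+1 + j = a j %[mod k].
  by rewrite (_ : e.+1 = n - j); [apply: sym | rewrite /j]; lia.
have sym_jS : a e + j.+1 = a j.+1 %[mod k].
  by rewrite {1}(_ : e = n - j.+1); [apply: sym | rewrite /j]; lia.
case: (step j j_n) => [ajE|ajE]; [right|left].
  apply: (@modn_addKl k j); rewrite addnC sym_j -ajE -sym_jS.
  by congr (_ %% _); lia.
have : a e.+1 = a e %[mod k].
  apply: (@modn_addKl k j.+1); rewrite [in RHS]addnC sym_jS ajE.
  by rewrite -[RHS]modnDml -sym_j modnDml; congr (_ %% _); lia.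
by rewrite (modn_small a_e) (modn_small a_eS).
Qed.

(** Modulo n, the last vertex of a spiral does not depend on the side on which
    it is added. *)
Lemma spiral_lastE n c delta :
  0 < n ->
  spiral n c delta n.-1 = c + (n - (left_steps delta n.-1).+1) %[mod n].
Proof.
move=> n_gt0; have := left_steps_le delta n.-1.
rewrite /spiral /arc_start left_stepsS; set W := left_steps _ _ => W_le.
case: (delta _) => /=; first by congr (_ %% _); lia.
by rewrite -[RHS]modnDr; congr (_ %% _); lia.
Qed.

Lemma spiral_translate n c c' delta delta' d :
  (forall e, e < n.-1 -> delta' e = delta e) -> d < n ->
  spiral n c' delta' d + c = spiral n c delta d + c' %[mod n].
Proof.
move=> deltaE d_lt_n.
have WE e : e <= n.-1 -> left_steps delta' e = left_steps delta e.
  by move=> e_le; apply: eq_big_nat => i i_lt; rewrite deltaE //; lia.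
have [d_lt|d_ge] := ltnP d n.-1.
  by rewrite /spiral /arc_start WE // deltaE //; congr (_ %% _); lia.
have -> : d = n.-1 by lia.
rewrite -modnDml -[RHS]modnDml !spiral_lastE; try lia.
by rewrite WE // !modnDml; congr (_ %% _); lia.
Qed.

Lemma spiral_surj n c delta x :
  0 < n -> exists2 d, d < n & spiral n c delta d = x %[mod n].
Proof.
move=> n_gt0.
have arcs d : d <= n -> forall s, s < d ->
    exists2 e, e < d & spiral n c delta e = arc_start n c delta d + s %[mod n].
  elim: d => [//|d IHd] d_lt_n s s_le.
  have lS := arc_startS c delta d_lt_n.
  have old s' : s' < d ->
      arc_start n c delta d + s' = arc_start n c delta d.+1 + s ->
      exists2 e, e < d.+1 &
        spiral n c delta e = arc_start n c delta d.+1 + s %[mod n].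
    move=> s'_lt <-; case: (IHd (ltnW d_lt_n) s' s'_lt) => e e_lt eE.
    by exists e => //; lia.
  have new : spiral n c delta d = arc_start n c delta d.+1 + s ->
      exists2 e, e < d.+1 &
        spiral n c delta e = arc_start n c delta d.+1 + s %[mod n].
    by move=> wE; exists d; rewrite ?wE.
  move: new lS; rewrite /spiral; case: (delta d) => /= new lS.
    case: s s_le old new => [|s] s_le old new; first exact: new.
    by apply: (old s); lia.
  have [s_eq|s_neq] := eqVneq s d; first by apply: new; rewrite s_eq.
  by apply: (old s); lia.
have [s s_lt xE] := modn_offset (arc_start n c delta n) x n_gt0.
by have [d d_lt dE] := arcs n (leqnn n) s s_lt; exists d; rewrite ?dE.
Qed.

(** * Vertices and positions *)

(** The residue class of i modulo n, as a vertex. *)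
Definition vertex (n : nat) (n_gt0 : 0 < n) (i : nat) : 'I_n :=
  Ordinal (ltn_pmod i n_gt0).

Section Vertex.

Variables (n : nat) (n_gt0 : 0 < n).
Local Notation vx := (vertex n_gt0).

Lemma vertex_eqP i j : vx i = vx j <-> i = j %[mod n].
Proof. by split=> [/(congr1 val)|ij] //; apply: val_inj. Qed.

Lemma vertexK (u : 'I_n) : vx u = u.
Proof. by apply: val_inj; rewrite /= modn_small. Qed.

Lemma vertex_addn i : vx (i + n) = vx i.
Proof. by apply/vertex_eqP; rewrite modnDr. Qed.

Lemma ordS_vertex i : ordS (vx i) = vx i.+1.
Proof. by apply: val_inj; rewrite /= -addn1 modnDml addn1. Qed.

Lemma sigma_vertex i : sigma n (vx i) = vx i.+1.
Proof. by rewrite /sigma permE ordS_vertex. Qed.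

Lemma sigma_expg_vertex m i : (sigma n ^+ m)%g (vx i) = vx (i + m).
Proof.
elim: m => [|m IHm]; first by rewrite expg0 perm1 addn0.
by rewrite expgSr permM IHm sigma_vertex addnS.
Qed.

Lemma ord_pred_vertex i : ord_pred (vx i.+1) = vx i.
Proof. by rewrite -ordS_vertex ordSK. Qed.

Lemma vertex_pair (u v : 'I_n) :
  u != v -> exists x d, [/\ 0 < d < n, u = vx x & v = vx (x + d)].
Proof.
move=> uv; have [d d_lt vE] := modn_offset u v n_gt0.
have vE' : v = vx (u + d) by rewrite -[LHS]vertexK; apply/vertex_eqP.
exists u, d; rewrite vertexK; split=> //; rewrite d_lt andbT lt0n.
by apply: contra uv => /eqP d0; rewrite vE' d0 addn0 vertexK.
Qed.

Lemma vertex_neq x d : 0 < d < n -> vx x != vx (x + d).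
Proof.
move=> d_n; apply/eqP => /vertex_eqP; rewrite -[in X in X = _](addn0 x).
by move/modn_addKl; rewrite !modn_small; lia.
Qed.

(** The position in tau of the vertex i modulo n. *)
Definition rank (tau : {perm 'I_n}) (i : nat) : nat := position tau (vx i).

Variable tau : {perm 'I_n}.

Lemma rank_cyclic : cyclic_ranking n (rank tau).
Proof.
split=> [x|x y]; first by rewrite /rank /position.
rewrite -vertex_eqP; split=> [/val_inj/perm_inj //|xy].
by rewrite /rank xy.
Qed.

Lemma rank_perm d : d < n -> rank tau (tau (vx d)) = d.
Proof. by move=> d_lt; rewrite /rank vertexK /position permK /= modn_small. Qed.

Lemma local_min_vertex i :
  local_min tau (vx i.+1) =
    (rank tau i.+1 < rank tau i) && (rank tau i.+1 < rank tau i.+2).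
Proof. by rewrite /local_min /precedes ord_pred_vertex ordS_vertex. Qed.

Lemma local_max_vertex i :
  local_max tau (vx i.+1) =
    (rank tau i < rank tau i.+1) && (rank tau i.+2 < rank tau i.+1).
Proof. by rewrite /local_max /precedes ord_pred_vertex ordS_vertex. Qed.

Lemma vertexS_surj (u : 'I_n) : exists i, u = vx i.+1.
Proof.
exists (u + n.-1); rewrite -addnS prednK // vertex_addn.
by rewrite vertexK.
Qed.

End Vertex.

(** * Cyclic partitions of the complete graph *)

Section Partition.

Variables (n k : nat) (n_gt0 : 0 < n) (F : 'I_k -> {set {set 'I_n}}).
Hypothesis (hF : sigma_partition F).
Local Notation vx := (vertex n_gt0).
Local Notation a := (defining_seq F).

Lemma partition_class (e : {set 'I_n}) d d' : e \in F d -> e \in F d' -> d = d'.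
Proof.
case: hF => injF /and3P[_ /trivIsetP triv _] _ ed ed'.
apply/eqP; apply: contraT => dd'.
have := triv (F d) (F d') (imset_f _ isT) (imset_f _ isT).
rewrite (inj_eq injF) => /(_ dd') /pred0P/(_ e).
by rewrite /= ed ed'.
Qed.

Lemma label_class (e : {set 'I_n}) d : e \in F d -> label F e = d.
Proof.
rewrite /label => ed; case: pickP => [d' ed'|/(_ d)]; last by rewrite ed.
by rewrite (partition_class ed' ed).
Qed.

Lemma edge_class (u v : 'I_n) : u != v -> exists d, [set u; v] \in F d.
Proof.
case: hF => _ /and3P[/eqP cov _ _] _ uv.
have : [set u; v] \in complete_graph n by rewrite inE cards2 uv.
by rewrite -cov /cover => /bigcupP[_ /imsetP[d _ ->] ed]; exists d.
Qed.

Lemma sigma_edge (s : {perm 'I_n}) (u v : 'I_n) :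
  s @: [set u; v] = [set s u; s v].
Proof. by rewrite imsetU !imset_set1. Qed.

Lemma class_sigma (e : {set 'I_n}) (d d' : 'I_k) :
  d' = d.+1 :> nat -> (sigma n @: e \in F d') = (e \in F d).
Proof.
case: hF => _ _ shift /shift <-.
apply/imsetP/idP => [[e' e'd /(imset_inj perm_inj) -> //]|ed].
by exists e.
Qed.

Lemma label_lt (u v : 'I_n) : u != v -> label F [set u; v] < k.
Proof.
by move=> uv; have [d ed] := edge_class uv; rewrite (label_class ed).
Qed.

(** For labels below k - 1 this is the definition of a cyclic partition.  Since
    the rotation permutes the edges and sends F_0, ..., F_{k-2} to
    F_1, ..., F_{k-1}, it must send F_{k-1} to F_0. *)
Lemma label_sigma (u v : 'I_n) : u != v ->
  label F [set sigma n u; sigma n v] = (label F [set u; v]).+1 %[mod k].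
Proof.
move=> uv; have [d ed] := edge_class uv; rewrite (label_class ed) -sigma_edge.
have [dS_lt|dS_ge] := ltnP d.+1 k.
  have dS : Ordinal dS_lt = d.+1 :> nat by [].
  by rewrite -(class_sigma _ dS) in ed; rewrite (label_class ed).
have suv : sigma n u != sigma n v by rewrite (inj_eq perm_inj).
have [d' ed'] := edge_class suv; rewrite -sigma_edge in ed'.
rewrite (label_class ed'); have := ltn_ord d; have := ltn_ord d' => d'_lt d_lt.
have -> : d.+1 = k by lia.
have [-> //|d'_gt0] := posnP d'; first by rewrite mod0n modnn.
have d'P_lt : d'.-1 < k by lia.
have d'P : d' = (Ordinal d'P_lt).+1 :> nat by rewrite /=; lia.
rewrite (class_sigma _ d'P) in ed'.
by have := congr1 val (partition_class ed ed') => /=; lia.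
Qed.

Lemma defining_seqE d : 0 < d < n -> a d = label F [set vx 0; vx d].
Proof.
move=> d_n; rewrite /defining_seq; congr (label F _).
apply/setP => u; rewrite !inE -!val_eqE /= mod0n modn_small //.
by case/andP: d_n.
Qed.

Lemma label_vertex x d : 0 < d < n ->
  label F [set vx x; vx (x + d)] = a d + x %[mod k].
Proof.
move=> d_n; elim: x => [|x IHx].
  by rewrite addn0 (defining_seqE d_n).
rewrite addSn -!sigma_vertex label_sigma ?vertex_neq //.
by rewrite -addn1 -modnDml IHx modnDml addn1 addnS.
Qed.

Lemma defining_seq_label_sequence : label_sequence n k a.
Proof.
split=> d d_n.
  by rewrite defining_seqE // label_lt // (vertex_neq n_gt0 0).
rewrite -label_vertex; last by lia.
rewrite subnKC; last by lia.
by rewrite (defining_seqE d_n) (vertex_addn n_gt0 0 : vx n = vx 0) setUC.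
Qed.

Lemma top_label x d : 0 < d < n ->
  (k %| a d + x.+1) = ((label F [set vx x; vx (x + d)]).+1 == k).
Proof.
move=> d_n; have lab_lt := label_lt (vertex_neq n_gt0 x d_n).
rewrite /dvdn addnS -addn1 -modnDml -label_vertex // modnDml addn1.
have [->|neq] := eqVneq _ k; first by rewrite modnn.
by rewrite modn_small //; lia.
Qed.

Section Orientation.

Variables (T : {set 'I_n * 'I_n}) (tau : {perm 'I_n}).
Hypotheses (orT : transitive_orientation T) (consT : consistent T tau).
Local Notation P := (rank n_gt0 tau).

Lemma consistent_arc u v : has_arc T u v = precedes tau u v.
Proof.
case: orT => irrT totT _; apply/idP/idP => [/consT //|uv].
have uv_neq : u != v by apply: contraTneq uv => ->; rewrite /precedes ltnn.
have := totT u v uv_neq; case Tuv: (has_arc T u v) => //= /consT vu.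
by move: vu; rewrite /precedes ltnNge (ltnW uv).
Qed.

Lemma arc_rankE x y : ((vx x, vx y) \in T) = (P x < P y).
Proof. exact: consistent_arc. Qed.

(** Invariance of the oriented classes under the rotation, in terms of
    positions. *)
Lemma sigma_orientationP :
  (forall d d' : 'I_k, d' = d.+1 :> nat ->
    act_digraph (sigma n) (oriented_subgraph T (F d)) =
      oriented_subgraph T (F d'))
  <-> rotation_compatible n k a P.
Proof.
split=> [sigT x d d_n|comp d d' d'E].
  rewrite top_label // -!arc_rankE addSn -!sigma_vertex => lab_neq.
  have [q eq] := edge_class (vertex_neq n_gt0 x d_n).
  rewrite (label_class eq) in lab_neq.
  have qS_lt : q.+1 < k by have := ltn_ord q; lia.
  have qS : Ordinal qS_lt = q.+1 :> nat by [].
  have /setP/(_ (sigma n (vx x), sigma n (vx (x + d)))) := sigT _ _ qS.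
  rewrite inE /= -sigma_edge (class_sigma _ qS) eq andbT => <-.
  apply/idP/imsetP => [Txy|[[u v]]].
    by exists (vx x, vx (x + d)); rewrite // inE Txy.
  by rewrite inE => /andP[Tuv _] /= [/perm_inj -> /perm_inj ->].
have arcT u v : [set u; v] \in F d ->
    ((sigma n u, sigma n v) \in T) = ((u, v) \in T).
  move=> ed; have [uv_eq|uv] := eqVneq u v.
    by rewrite uv_eq; case: orT => irrT _ _; rewrite [LHS]irrT [RHS]irrT.
  have [x [m [m_n uE vE]]] := vertex_pair n_gt0 uv.
  rewrite {}uE {}vE in uv ed *.
  rewrite !sigma_vertex -addSn !arc_rankE -comp // top_label //
    (label_class ed).
  by have := ltn_ord d'; lia.
apply/setP => -[p q]; apply/imsetP/idP => [[[u v]]|].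
  rewrite inE => /andP[Tuv /= ed] [-> ->]; rewrite inE /= arcT // Tuv.
  by rewrite -sigma_edge (class_sigma _ d'E).
rewrite inE /= => /andP[Tpq epq].
exists (((sigma n)^-1)%g p, ((sigma n)^-1)%g q); last by rewrite /= !permKV.
have ed : [set ((sigma n)^-1)%g p; ((sigma n)^-1)%g q] \in F d.
  by rewrite -(class_sigma _ d'E) sigma_edge !permKV.
by rewrite inE /= ed andbT -arcT // !permKV.
Qed.

End Orientation.

End Partition.

(** * Bitonic orderings and spirals *)

Lemma position_inj n (tau : {perm 'I_n}) : injective (position tau).
Proof. by move=> u v /val_inj/perm_inj. Qed.

(** The transitive tournament in which every arc follows the ordering tau. *)
Definition ordering_tournament n (tau : {perm 'I_n}) : {set 'I_n * 'I_n} :=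
  [set p | precedes tau p.1 p.2].

Lemma ordering_consistent n (tau : {perm 'I_n}) :
  consistent (ordering_tournament tau) tau.
Proof. by move=> u v; rewrite /has_arc /= inE. Qed.

Lemma ordering_transitive n (tau : {perm 'I_n}) :
  transitive_orientation (ordering_tournament tau).
Proof.
split=> [u|u v uv|v u w]; rewrite /has_arc /= !inE /= /precedes.
- by rewrite ltnn.
- have := contra_neq (@position_inj _ tau u v) uv; lia.
exact: ltn_trans.
Qed.

Section Bitonic.

Variables (n : nat) (n_gt1 : 1 < n).
Local Notation n_gt0 := (ltnW n_gt1).
Local Notation vx := (vertex n_gt0).

Section Ordering.

Variable tau : {perm 'I_n}.
Local Notation P := (rank n_gt0 tau).

Lemma rank_succ_neq i : P i != P i.+1.
Proof.
by apply/eqP; case: (rank_cyclic n_gt0 tau) => _ ->;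
  move/esym/modn_succ_neq; apply.
Qed.

Lemma first_local_min u : position tau u = 0 -> local_min tau u.
Proof.
have [i ->] := vertexS_surj n_gt0 u.
rewrite -/(rank n_gt0 tau i.+1) local_min_vertex.
by have := rank_succ_neq i; have := rank_succ_neq i.+1; lia.
Qed.

Lemma last_local_max v : position tau v = n.-1 -> local_max tau v.
Proof.
have [i ->] := vertexS_surj n_gt0 v.
rewrite -/(rank n_gt0 tau i.+1) local_max_vertex.
have [P_lt _] := rank_cyclic n_gt0 tau; have := P_lt i; have := P_lt i.+2.
by have := rank_succ_neq i; have := rank_succ_neq i.+1; lia.
Qed.

Lemma position_first : position tau (tau (vx 0)) = 0.
Proof. by rewrite /position permK /= mod0n. Qed.

Lemma position_last : position tau (tau (vx n.-1)) = n.-1.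
Proof. by rewrite /position permK /= modn_small //; lia. Qed.

Section SpiralOrdering.

Variables (c : nat) (delta : nat -> bool).
Hypothesis P_spiral : forall d, d < n -> P (spiral n c delta d) = d.

Lemma spiral_local_minE u :
  position tau u = 0 -> forall j, local_min tau j <-> j = u.
Proof.
move=> u0 j; split=> [|->]; last exact: first_local_min.
have [i ->] := vertexS_surj n_gt0 j; rewrite local_min_vertex => /andP[lt1 lt2].
apply: (@position_inj _ tau); rewrite u0.
exact: (spiral_local_min n_gt1 (rank_cyclic _ _) P_spiral).
Qed.

Lemma spiral_local_maxE v :
  position tau v = n.-1 -> forall j, local_max tau j <-> j = v.
Proof.
move=> v_last j; split=> [|->]; last exact: last_local_max.
have [i ->] := vertexS_surj n_gt0 j; rewrite local_max_vertex => /andP[lt1 lt2].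
apply: (@position_inj _ tau); rewrite v_last.
exact: (spiral_local_max n_gt1 (rank_cyclic _ _) P_spiral).
Qed.

Lemma spiral_bitonic : bitonic tau.
Proof.
split.
  exists (tau (vx 0)); split=> [|j].
    exact: first_local_min position_first.
  by move/(spiral_local_minE position_first).
exists (tau (vx n.-1)); split=> [|j]; first exact: last_local_max position_last.
by move/(spiral_local_maxE position_last).
Qed.

End SpiralOrdering.

(** Only the uniqueness of the local minimum is used; that of the local maximum
    follows. *)
Lemma bitonic_spiral : bitonic tau ->
  exists delta, delta 0 = false /\
    forall d, d < n -> P (spiral n (tau (vx 0)) delta d) = d.
Proof.
case=> -[u [_ u_unique]] _.
apply: (@spiral_of_unimodal n P (fun d => tau (vx d))) => //.
- exact: rank_cyclic.
- by move=> d; exact: rank_perm.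
move=> x lt1 lt2; have min_x : local_min tau (vx x.+1).
  by rewrite local_min_vertex lt1.
rewrite /rank -(u_unique _ min_x).
by rewrite (u_unique _ (first_local_min position_first)) position_first.
Qed.

End Ordering.

Lemma spiral_ordering c delta :
  exists tau : {perm 'I_n},
    forall d, d < n -> rank n_gt0 tau (spiral n c delta d) = d.
Proof.
pose f (d : 'I_n) := vx (spiral n c delta d).
have f_surj u : exists d, f d == u.
  have [d d_lt dE] := spiral_surj c delta u n_gt0.
  exists (Ordinal d_lt); rewrite -[u in _ == u](vertexK n_gt0).
  by apply/eqP/vertex_eqP.
pose g u := xchoose (f_surj u).
have gK : cancel g f by move=> u; apply/eqP; exact: (xchooseP (f_surj u)).
have fK := canF_sym gK.
exists (perm (can_inj fK)) => d d_lt.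
rewrite -[RHS](rank_perm n_gt0 (perm (can_inj fK)) d_lt) permE.
by rewrite /rank vertexK /f /= modn_small.
Qed.

End Bitonic.

(** * Standard orientations *)

Section Standard.

Variables (k n : nat) (k_gt1 : 1 < k) (n_gt1 : 1 < n).
Variables (F : 'I_k -> {set {set 'I_n}}) (hF : sigma_partition F).
Local Notation n_gt0 := (ltnW n_gt1).
Local Notation vx := (vertex n_gt0).
Local Notation a := (defining_seq F).

Let lab_a : label_sequence n k a := defining_seq_label_sequence n_gt0 hF.

(** The orientation determines which vertices are local extrema, so any ordering
    consistent with a standard orientation is bitonic. *)
Lemma standard_spiral T tau :
  standard_orientation F T -> consistent T tau ->
  exists delta, [/\ delta 0 = false,
    forall d, d < n -> rank n_gt0 tau (spiral n (tau (vx 0)) delta d) = d &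
    label_spiral n k (tau (vx 0)) a delta].
Proof.
case=> -[orT sigT] [tau' [consT' bitT']] consT.
have precE u v : precedes tau u v = precedes tau' u v.
  by rewrite -(consistent_arc orT consT) (consistent_arc orT consT').
have minE j : local_min tau j = local_min tau' j by rewrite /local_min !precE.
have maxE j : local_max tau j = local_max tau' j by rewrite /local_max !precE.
have bit_tau : bitonic tau.
  case: bitT' => -[u [min_u u_unique]] [v [max_v v_unique]]; split.
    by exists u; split=> [|j]; rewrite minE // => /u_unique.
  by exists v; split=> [|j]; rewrite maxE // => /v_unique.
have [delta [delta0 P_spiral]] := bitonic_spiral n_gt1 bit_tau.
exists delta; split=> //.
apply: (compatible_label_spiral n_gt1 _ P_spiral); first exact: rank_cyclic.
exact/(sigma_orientationP n_gt0 hF orT consT).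
Qed.

(** With n = 2 h, the edge {0, h} is sent to itself by h rotations, so that k
    divides h. *)
Lemma label_spiral_dvd c delta :
  delta 0 = false -> label_spiral n k c a delta -> 2 * k %| n.
Proof.
move=> delta0 lab_l.
have step e := label_spiral_step (d := e) lab_l.
have nE := left_steps_half n_gt1 k_gt1 lab_a delta0 step.
pose h := (left_steps delta n.-1).+1; have nE' : n = 2 * h by rewrite /h; lia.
have h_n : 0 < h < n by rewrite /h; lia.
have [_ /(_ h h_n)] := lab_a.
have -> : n - h = h by lia.
move/eqP; rewrite -[X in _ == X %[mod _]](addn0 (a h)) eqn_modDl mod0n => kh.
by rewrite nE' dvdn_pmul2l.
Qed.

Lemma standard_unique T T' :
  standard_orientation F T -> standard_orientation F T' ->
  exists m, T' = act_digraph ((sigma n ^+ k) ^+ m)%g T.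
Proof.
move=> stT stT'.
have [[orT _] [tau [consT _]]] := stT.
have [[orT' _] [tau' [consT' _]]] := stT'.
have [delta [delta0 P_spiral lab_l]] := standard_spiral stT consT.
have [delta' [delta0' P_spiral' lab_l']] := standard_spiral stT' consT'.
set c : nat := tau _ in P_spiral lab_l.
set c' : nat := tau' _ in P_spiral' lab_l'.
have step e := label_spiral_step (d := e) lab_l.
have step' e := label_spiral_step (d := e) lab_l'.
have kn : k %| n.
  by apply: dvdn_trans (label_spiral_dvd delta0 lab_l); rewrite dvdn_mull.
have deltaE e : e < n.-1 -> delta' e = delta e.
  case: e => [|e] e_lt; first by rewrite delta0 delta0'.
  by apply: (modn_bool_inj (x := a e.+1) k_gt1); rewrite -step -?step'; lia.
have start1 b d : d 0 = false -> label_spiral n k b a d -> k %| a 1 + b.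
  move=> d0 /(_ 1 n_gt1).
  by rewrite /arc_start left_stepsS left_steps0 d0 subn0 addnA dvdn_addl.
have c_lt : c < n := ltn_ord _.
pose D := c' + (n - c).
have /dvdnP[m DE] : k %| D.
  have := start1 _ _ delta0' lab_l'; have := start1 _ _ delta0 lab_l.
  move=> kc kc'; rewrite -(dvdn_addr _ kc) /D.
  rewrite (_ : _ + _ = a 1 + c' + n); last by lia.
  by rewrite dvdn_add.
exists m; rewrite -expgM mulnC -DE.
(* Both orderings are spirals with the same steps, so that they differ by the
   rotation that carries the first vertex c of tau to the first vertex c' of
   tau'. *)
have shift x : rank n_gt0 tau' (x + D) = rank n_gt0 tau x.
  have [P_lt P_eq] := rank_cyclic n_gt0 tau.
  have [_ P_eq'] := rank_cyclic n_gt0 tau'.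
  pose d := rank n_gt0 tau x; have d_lt : d < n := P_lt x.
  have xE : x = spiral n c delta d %[mod n] by apply/P_eq; rewrite P_spiral.
  rewrite -/d -[RHS]P_spiral' //; apply/P_eq'.
  rewrite -modnDml xE modnDml /D addnA -modnDml.
  rewrite -(spiral_translate c c' deltaE) // modnDml.
  by rewrite -addnA subnKC ?modnDr // ltnW.
have arcE u v :
    ((sigma n ^+ D)%g u, (sigma n ^+ D)%g v) \in T' = ((u, v) \in T).
  rewrite -[u](vertexK n_gt0) -[v](vertexK n_gt0) !sigma_expg_vertex.
  by rewrite (arc_rankE n_gt0 orT' consT') (arc_rankE n_gt0 orT consT) !shift.
apply/setP => -[p q]; apply/idP/imsetP => [Tpq|[[u v] Tuv [-> ->]]]; last first.
  by rewrite arcE.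
exists (((sigma n ^+ D)^-1)%g p, ((sigma n ^+ D)^-1)%g q).
  by rewrite -arcE !permKV.
by rewrite /= !permKV.
Qed.

Lemma standard_extrema T tau u v :
  standard_orientation F T -> consistent T tau ->
  position tau u = 0 -> position tau v = n.-1 ->
  [/\ (forall j, local_min tau j <-> j = u),
      (forall j, local_max tau j <-> j = v) &
      v = u + n %/ 2 %[mod n]].
Proof.
move=> stT consT u_first v_last.
have [delta [delta0 P_spiral lab_l]] := standard_spiral stT consT.
have uE : u = tau (vx 0).
  by apply: (@position_inj _ tau); rewrite u_first (position_first n_gt1).
rewrite -uE in P_spiral lab_l.
split; first exact: (spiral_local_minE P_spiral u_first).
  exact: (spiral_local_maxE P_spiral v_last).
have step e := label_spiral_step (d := e) lab_l.
have nE := left_steps_half n_gt1 k_gt1 lab_a delta0 step.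
have [_ P_eq] := rank_cyclic n_gt0 tau.
transitivity (spiral n u delta n.-1 %% n).
  by apply/P_eq; rewrite P_spiral /rank ?vertexK //; lia.
by rewrite spiral_lastE ?n_gt0 //; congr (_ %% _); lia.
Qed.

Lemma standard_exists :
  2 * k %| n ->
  (forall j, 0 < j <= n %/ 2 - 1 ->
    a j.+1 = a j \/ a j.+1 = a j + 1 %[mod k]) ->
  exists T, standard_orientation F T.
Proof.
move=> kn step2.
have n_even : 2 %| n by apply: dvdn_trans kn; rewrite dvdn_mulr.
have {}kn : k %| n by apply: dvdn_trans kn; rewrite dvdn_mull.
pose delta d := (0 < d) && (a d.+1 != a d).
have step e : 0 < e < n.-1 -> a e.+1 = a e + delta e %[mod k].
  move=> e_n; rewrite /delta; have -> : 0 < e by lia.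
  case: eqVneq => [-> /=|neq /=]; first by rewrite addn0.
  case: (label_steps_extend lab_a n_even step2 e_n) => // eq.
  by rewrite eq eqxx in neq.
have a1_lt : a 1 < k by case: lab_a => a_lt _; apply: a_lt.
(* The first vertex must satisfy a_1 + c = 0 modulo k. *)
pose c := k - a 1.
have lab_l : label_spiral n k c a delta.
  by apply: label_spiral_of_steps => //; rewrite /c subnKC // ltnW.
have [tau P_spiral] := spiral_ordering n_gt1 c delta.
pose T := ordering_tournament tau.
have orT : transitive_orientation T := ordering_transitive tau.
have consT : consistent T tau := @ordering_consistent _ tau.
exists T; split; last by exists tau; split=> //; exact: spiral_bitonic P_spiral.
split=> //; apply/(sigma_orientationP n_gt0 hF orT consT).
apply: (label_spiral_compatible n_gt1 lab_a _ P_spiral kn lab_l).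
exact: rank_cyclic.
Qed.

End Standard.

Theorem theorem3 (k n : nat) (hk : 1 < k) (hn : 1 < n)
    (F : 'I_k -> {set {set 'I_n}}) (hF : sigma_partition F) :
  [/\ (exists T : {set 'I_n * 'I_n}, standard_orientation F T) <->
        (2 * k %| n /\
         forall j : nat, 1 <= j <= n %/ 2 - 1 ->
           defining_seq F j.+1 = defining_seq F j \/
           defining_seq F j.+1 = defining_seq F j + 1 %[mod k]),
      forall T T' : {set 'I_n * 'I_n},
        standard_orientation F T -> standard_orientation F T' ->
        exists m : nat, T' = act_digraph ((sigma n ^+ k) ^+ m)%g T &
      forall (T : {set 'I_n * 'I_n}) (tau : {perm 'I_n}) (u v : 'I_n),
        standard_orientation F T -> consistent T tau ->
        position tau u = 0 -> position tau v = n.-1 ->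
        [/\ (forall j : 'I_n, local_min tau j <-> j = u),
            (forall j : 'I_n, local_max tau j <-> j = v) &
            v = u + n %/ 2 %[mod n]]].
Proof.
split; first 1 last.
- exact: standard_unique.
- by move=> T tau u v; exact: standard_extrema.
split=> [[T stT]|[kn step]]; last exact: standard_exists.
have [_ [tau [consT _]]] := stT.
have [delta [delta0 _ lab_l]] := standard_spiral hn hF stT consT.
split=> [|j j_n]; first exact: (label_spiral_dvd hk hn hF delta0 lab_l).
have j_lt : 0 < j < n.-1 by move: (leq_divM n 2); lia.
have jS_lt : 0 < j < n /\ 0 < j.+1 < n by lia.
have := label_spiral_step lab_l j_lt.
have [a_lt _] := defining_seq_label_sequence (ltnW hn) hF.
have := a_lt _ (proj1 jS_lt); have := a_lt _ (proj2 jS_lt).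
case: (delta j) => [_ _|aS_lt a_j]; first by right.
by rewrite addn0 (modn_small aS_lt) (modn_small a_j); left.
Qed.
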